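(* Let $\kappa$ be a regular uncountable cardinal and $\lambda>\kappa$ a cardinal. (i) There is an ideal $H$ on $P_\kappa(\lambda)$ such that (a) $\mathfrak a_H=\kappa$, (b) $\mathrm{cof}(H)=\mathfrak d^\kappa_{\kappa,\lambda}$, and (c) $\overline{\mathrm{cof}}(H)\le\overline{\mathfrak d}^\kappa_{\kappa,\lambda}$. (ii) There is an ideal $K$ on $P_\kappa(\lambda)$ such that (a) $K$ is not a weak $\pi$-point, (b) $\mathrm{cof}(K)=\mathfrak d^\kappa_{\kappa,\lambda}$, and (c) $\overline{\mathrm{cof}}(K)\le\overline{\mathfrak d}^\kappa_{\kappa,\lambda}$.
   Context: For a cardinal $\mu$ and a set $A$, $P_\mu(A)=\{a\subseteq A:|a|<\mu\}$. An ideal on an infinite set $S$ is a collection $K$ of subsets of $S$ containing all singletons, closed under subsets and finite unions, with $S\notin K$; $K^+=P(S)\setminus K$. $\mathrm{cof}(K)$ is the least cardinality of an $X\subseteq K$ with $K=\bigcup_{A\in X}P(A)$; $\overline{\mathrm{cof}}(K)$ is the least cardinality of an $X\subseteq K$ with $K=\bigcup\{P(\bigcup x):x\in P_\kappa(X)\}$. $I_{\kappa,\lambda}$ is the set of all $A\subseteq P_\kappa(\lambda)$ such that $A\cap\{b\in P_\kappa(\lambda):a\subseteq b\}=\emptyset$ for some $a\in P_\kappa(\lambda)$. ''Ideal on $P_\kappa(\lambda)$'' always means an ideal $H$ on $P_\kappa(\lambda)$ that is $\kappa$-complete (closed under unions of fewer than $\kappa$ members) and fine ($I_{\kappa,\lambda}\subseteq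 H$). $\mathfrak d^\kappa_{\kappa,\lambda}$ is the least cardinality of an $F\subseteq{}^\kappa(P_\kappa(\lambda))$ such that for every $g\in{}^\kappa(P_\kappa(\lambda))$ there is $f\in F$ with $g(\alpha)\subseteq f(\alpha)$ for all $\alpha\in\kappa$. $\overline{\mathfrak d}^\kappa_{\kappa,\lambda}$ is the least cardinality of an $X\subseteq{}^\kappa(P_\kappa(\lambda))$ such that for every $g\in{}^\kappa(P_\kappa(\lambda))$ there is $x\in P_\kappa(X)$ with $g(\alpha)\subseteq\bigcup_{f\in x}f(\alpha)$ for every $\alpha<\kappa$. For an ideal $H$ on $P_\kappa(\lambda)$, $\mathcal M_H^{\ge\kappa}$ is the set of all $Q\subseteq H^+$ such that (i) $|Q|\ge\kappa$, (ii) $A\cap B\in H$ for all distinct $A,B\in Q$, and (iii) for every $C\in H^+$ there is $A\in Q$ with $A\cap C\in H^+$. $\mathfrak a_H$ is the least cardinality of a member of $\mathcal M_H^{\ge\kappa}$ if $\mathcal M_H^{\ge\kappa}\neq\emptyset$, and $2^{(\lambda^{<\kappa})^+}$ otherwise. $H$ is a weak $\pi$-point if for every $f\in{}^\kappa H$ and $A\in H^+$ there is $B\in H^+\cap P(A)$ such that $B\cap f(\alpha)\in I_{\kappa,\lambda}$ for every $\alpha\in\kappa$. *)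

(* Defs.v *)
From mathcomp Require Import all_boot all_order.
From mathcomp Require Import all_classical.

Set Implicit Arguments.
Unset Strict Implicit.
Unset Printing Implicit Defensive.

Local Open Scope classical_set_scope.
Local Open Scope card_scope.

(** * Cardinals *)

Definition card_lt T U (A : set T) (B : set U) : Prop :=
  A #<= B /\ ~~ (B #<= A).
Notation "A '#<' B" := (card_lt A B)
  (at level 79, format "A  '#<'  B") : card_scope.

(** A cardinal is an initial ordinal: a well-order all of whose proper initial
    segments are of strictly smaller cardinality. *)
Definition is_cardinal d (kappa : orderType d) : Prop :=
  well_founded (fun a b : kappa => (a < b)%O) /\
  forall a : kappa, [set b : kappa | (b < a)%O] #< [set: kappa].

Definition cofinal d (kappa : orderType d) (C : set kappa) : Prop :=
  forall a : kappa, exists2 b, C b & (a <= b)%O.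

Definition regular_uncountable d (kappa : orderType d) : Prop :=
  [/\ is_cardinal kappa,
      ~ countable [set: kappa] &
      forall C : set kappa, cofinal C -> C #= [set: kappa]].

(** A member of [P] of least cardinality; the "least cardinality of a member
    of [P]" is the cardinality of [least_card P].  It exists as soon as [P] is
    nonempty, by [least_cardP]. *)
Definition least_card T (P : set (set T)) : set T :=
  xget set0 [set X | P X /\ forall Y, P Y -> X #<= Y].

Lemma least_cardP T (P : set (set T)) : P !=set0 ->
  P (least_card P) /\ forall Y, P Y -> least_card P #<= Y.
Proof.
move=> [X0 PX0]; rewrite /least_card.
suff: exists X, P X /\ forall Y, P Y -> X #<= Y by move/(xgetPex set0).
(* A maximal set of selectors of P, injective at each coordinate, is onto at
   some coordinate. *)
pose good (F : set (set T -> T)) := forall X, P X ->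
  (forall g, F g -> X (g X)) /\
  (forall g h, F g -> F h -> g X = h X -> g = h).
have [|F [gF maxF]] := @Zorn_bigcup _ good.
  move=> C Cgood Ctot X PX; split=> [g [F CF Fg]|g h [F CF Fg] [G CG Gh]].
    by have [+ _] := Cgood _ CF X PX; apply.
  have [FG|GF] := Ctot _ _ CF CG.
    by have [_] := Cgood _ CG X PX; apply=> //; apply: FG.
  by have [_] := Cgood _ CF X PX; apply=> //; apply: GF.
have [[X [PX Xonto]]|noX] := pselect (exists X, P X /\
    forall t, X t -> exists2 g, F g & g X = t).
  exists X; split=> // Y PY.
  have [FX injX] := gF X PX; have [FY injY] := gF Y PY.
  rewrite -(_ : (fun g : set T -> T => g X) @` F = X); last first.
    apply/seteqP; split=> [t [g Fg <-]|t /Xonto[g Fg gt]]; first exact: FX.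
    by exists g.
  rewrite (card_le_eql (inj_card_eq _)).
    rewrite -(card_le_eql (inj_card_eq (f := fun g : set T -> T => g Y) _)).
      by apply: subset_card_le => t [g Fg <-]; apply: FY.
    by move=> g h /set_mem Fg /set_mem Fh; apply: injY.
  by move=> g h /set_mem Fg /set_mem Fh; apply: injX.
have miss X : P X -> exists t, X t /\ forall g, F g -> g X <> t.
  move=> PX; apply: contrapT => nt; apply: noX; exists X; split=> // t Xt.
  apply: contrapT => ng; apply: nt; exists t; split=> // g Fg gt.
  by apply: ng; exists g.
have [t0 _] := miss _ PX0.
have /choice[g0 g0P] X : exists t, P X -> X t /\ forall g, F g -> g X <> t.
  by have [/miss[t]|nPX] := pselect (P X); [exists t|exists t0].
exfalso; apply: (maxF (F `|` [set g0])).
  split=> [g Fg|sub]; first by left.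
  by have [_ /(_ g0 (sub g0 (or_intror erefl)))] := g0P _ PX0.
move=> X PX; have [X0t X0n] := g0P _ PX; have [FX injX] := gF X PX.
split=> [g [/FX//|->//]|g h [Fg|->] [Fh|->]] //; first exact: injX.
- by move=> /(X0n _ Fg).
- by move=> /esym /(X0n _ Fh).
Qed.

(** [P_mu(A)]: the subsets of [A] of cardinality less than that of [mu]. *)
Definition subsets_lt (mu : Type) T (A : set T) : set (set T) :=
  [set a | a `<=` A /\ a #< [set: mu]].

(** [P_kappa(lambda)] *)
Definition Pkl (kappa lambda : Type) : Type :=
  set_type (subsets_lt kappa [set: lambda]).

(** The element [a] of [P_kappa(lambda)] as a subset of [lambda]. *)
Definition elts (kappa lambda : Type) (a : Pkl kappa lambda) : set lambda :=
  sval a.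

(** The cardinal successor of [|T|], as a subset of the power set of [T]: by
    Cantor's theorem some subset of [set T] is of cardinality above [|T|]. *)
Definition succ_card (T : Type) : Type :=
  set_type (least_card [set A : set (set T) | [set: T] #< A]).

(** The sequences of elements of [lambda] indexed by an ordinal less than
    [kappa]; their number is [lambda^{<kappa}]. *)
Definition sequences_lt d (kappa : orderType d) (lambda : Type) : Type :=
  {a : kappa & set_type [set b : kappa | (b < a)%O] -> lambda}.

(** * Ideals *)

Definition is_ideal S (K : set (set S)) : Prop :=
  infinite_set [set: S] /\
  [/\ forall s : S, K [set s],
      forall A B : set S, K B -> A `<=` B -> K A,
      forall X : set (set S), finite_set X -> X `<=` K -> K (\bigcup_(A in X) A) &
      ~ K [set: S]].

Definition positive S (K : set (set S)) : set (set S) := ~` K.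

Definition cof S (K : set (set S)) : set (set S) :=
  least_card [set X | X `<=` K /\ K = \bigcup_(A in X) [set B | B `<=` A]].

Definition cofbar (kappa : Type) S (K : set (set S)) : set (set S) :=
  least_card [set X | X `<=` K /\
    K = \bigcup_(x in subsets_lt kappa X) [set B | B `<=` \bigcup_(A in x) A]].

(** [I_{kappa,lambda}] *)
Definition bounded_ideal (kappa lambda : Type) : set (set (Pkl kappa lambda)) :=
  [set A | exists a : Pkl kappa lambda,
    A `&` [set b | elts a `<=` elts b] = set0].
Arguments bounded_ideal : clear implicits.

Definition is_Pkl_ideal (kappa lambda : Type) (H : set (set (Pkl kappa lambda))) :
    Prop :=
  [/\ is_ideal H,
      forall X : set (set (Pkl kappa lambda)),
        X #< [set: kappa] -> X `<=` H -> H (\bigcup_(A in X) A) &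
      bounded_ideal kappa lambda `<=` H].

(** [M_H^{>=kappa}] *)
Definition mad_families (kappa lambda : Type) (H : set (set (Pkl kappa lambda))) :
    set (set (set (Pkl kappa lambda))) :=
  [set Q | Q `<=` positive H /\
    [/\ [set: kappa] #<= Q,
        forall A B, Q A -> Q B -> A <> B -> H (A `&` B) &
        forall C, positive H C -> exists2 A, Q A & positive H (A `&` C)]].

(** [a_H]; the value [2 ^ ((lambda^{<kappa})^+)] is taken when there is no
    suitable family. *)
Definition mad_number d (kappa : orderType d) (lambda : Type)
    (H : set (set (Pkl kappa lambda))) : Type :=
  if pselect (mad_families H !=set0) then set_type (least_card (mad_families H))
  else succ_card (sequences_lt kappa lambda) -> bool.

Definition weak_pi_point (kappa lambda : Type)
    (H : set (set (Pkl kappa lambda))) : Prop :=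
  forall (f : kappa -> set (Pkl kappa lambda)) (A : set (Pkl kappa lambda)),
    (forall alpha, H (f alpha)) -> positive H A ->
    exists B, [/\ positive H B, B `<=` A &
      forall alpha, bounded_ideal kappa lambda (B `&` f alpha)].

(** * Dominating numbers *)

(** [d^kappa_{kappa,lambda}] *)
Definition dom_number (kappa lambda : Type) : set (kappa -> Pkl kappa lambda) :=
  least_card [set F | forall g : kappa -> Pkl kappa lambda,
    exists2 f, F f & forall alpha, elts (g alpha) `<=` elts (f alpha)].
Arguments dom_number : clear implicits.

(** [\overline{d}^kappa_{kappa,lambda}] *)
Definition dombar_number (kappa lambda : Type) :
    set (kappa -> Pkl kappa lambda) :=
  least_card [set X | forall g : kappa -> Pkl kappa lambda,
    exists2 x, subsets_lt kappa X x &
      forall alpha, elts (g alpha) `<=` \bigcup_(f in x) elts (f alpha)].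
Arguments dombar_number : clear implicits.

(* Main.v *)
(** Choose an injection of [kappa] into [lambda] and [kappa] many pairwise
    disjoint subsets [W x] of [P_kappa(lambda)], each cofinal for inclusion.  Let
    [H] consist of the [A] meeting every [W x] in a set of [I_{kappa,lambda}], and
    [K] of the [A] for which this holds for all sufficiently large [x].  The
    fibres [W x] form a maximal almost disjoint family for [H], whereas they all
    belong to [K], and a set which meets each of them in [I_{kappa,lambda}] is in
    [K].  Both ideals are generated by sets given by functions
    [g : kappa -> P_kappa(lambda)] (a point [b] of [W x] is in the set iff [g x] is
    not contained in [b]), and such a set determines [g x] up to replacing it by
    the intersection of the members of [W x] containing it. *)

Require Import Defs.
From mathcomp Require Import all_boot all_order.
From mathcomp Require Import all_classical.

Import Order.TTheory.

Local Open Scope classical_set_scope.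
Local Open Scope card_scope.

(** * Injections and comparability of cardinals *)

Lemma inj_on_card_le {T U} {A : set T} {B : set U} (f : T -> U) :
  (forall x, A x -> B (f x)) -> {in A &, injective f} -> A #<= B.
Proof.
move=> AB injf; rewrite -(card_le_eql (inj_card_eq injf)).
by apply: subset_card_le => _ [x Ax <-]; apply: AB.
Qed.

Lemma card_le_inj_on {T U} (u : U) {A : set T} {B : set U} : A #<= B ->
  exists f : T -> U, (forall x, A x -> B (f x)) /\ {in A &, injective f}.
Proof.
move=> /card_leP[f].
pose g x := if pselect (A x) is left Ax then sval (f (SigSub (mem_set Ax))) else u.
exists g; split=> [x Ax|x y /set_mem Ax /set_mem Ay]; rewrite /g; case: pselect => // Ax'.
  by apply: set_mem; apply: valP.
case: pselect => // Ay' /val_inj fxy.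
by have /(congr1 val) := @inj _ _ _ f _ _ (mem_set I) (mem_set I) fxy.
Qed.

(** The two sets are copied into the sum type [T + U], where [least_cardP] applied to the pair of
    copies singles out one of least cardinality. *)
Lemma card_le_total {T U} (A : set T) (B : set U) : A #<= B \/ B #<= A.
Proof.
have eA : @inl T U @` A #= A by apply: inj_card_eq => x y _ _ [].
have eB : @inr T U @` B #= B by apply: inj_card_eq => x y _ _ [].
have [] := @least_cardP _ [set @inl T U @` A; @inr T U @` B].
  by exists (inl @` A); left.
case=> -> le; [left|right].
  have := le _ (or_intror erefl).
  by rewrite (card_le_eql eA) (card_le_eqr eB).
by have := le _ (or_introl erefl); rewrite (card_le_eql eB) (card_le_eqr eA).
Qed.

Lemma card_ltNge {T U} (A : set T) (B : set U) : ~ (B #<= A) -> A #< B.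
Proof. by move=> nBA; split; [case: (card_le_total A B)|apply/negP]. Qed.

Lemma card_le_lt_trans {T U V} (A : set T) (B : set U) (C : set V) :
  A #<= B -> B #< C -> A #< C.
Proof.
move=> AB [BC /negP nCB]; split; first exact: card_le_trans BC.
by apply/negP => /card_le_trans/(_ AB).
Qed.

(** * Sets smaller than a regular uncountable cardinal *)

Section RegularCardinal.
Context {d : Order.disp_t} (kappa : orderType d).
Hypothesis regular_kappa : regular_uncountable kappa.

Lemma regular_infinite : infinite_set [set: kappa].
Proof. by case: regular_kappa => _ + _ => /[swap] /finite_set_countable. Qed.

Lemma regular_inhabited : exists o : kappa, True.
Proof.
have [E|/set0P[o _]] := eqVneq [set: kappa] set0; last by exists o.
by case: regular_infinite; rewrite E.
Qed.

Lemma finite_card_lt T (A : set T) : finite_set A -> A #< [set: kappa].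
Proof.
move=> finA; apply: card_ltNge => /card_le_finite/(_ finA).
exact: regular_infinite.
Qed.

Lemma lt_segment_card (a : kappa) : [set b | (b < a)%O] #< [set: kappa].
Proof. by have [[_]] := regular_kappa. Qed.

(** A set without strict upper bound is cofinal, hence of full cardinality by regularity. *)
Lemma regular_bounded (Z : set kappa) : Z #< [set: kappa] ->
  exists a, forall z, Z z -> (z < a)%O.
Proof.
have [_ _ reg] := regular_kappa; move=> [_ /negP nZ]; apply: contrapT => nb.
apply: nZ; suff /reg/card_eqPle[] : cofinal Z by [].
move=> a; apply: contrapT => na; apply: nb; exists a => z Zz.
rewrite ltNge; apply/negP => az; by apply: na; exists z.
Qed.

Lemma regular_succ (a : kappa) : exists b, (a < b)%O.
Proof.
have [b bP] := @regular_bounded [set a] (finite_card_lt _ _ (finite_set1 _)).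
by exists b; apply: bP.
Qed.

Lemma lt_le_segment_card (a : kappa) : [set b | (b <= a)%O] #< [set: kappa].
Proof.
have [b ab] := regular_succ a; apply: card_le_lt_trans (lt_segment_card b).
by apply: subset_card_le => c /= ca; apply: le_lt_trans ab.
Qed.

Lemma regular_tail_inj (a : kappa) :
  exists2 s : kappa -> kappa, injective s & forall b, (a < s b)%O.
Proof.
have [_ _ reg] := regular_kappa.
have /reg/card_eqPle[_] : cofinal [set b : kappa | (a < b)%O].
  move=> c; have [b] := regular_succ (Order.max a c).
  rewrite gt_max => /andP[ab cb]; exists b => //.
  exact: ltW.
move=> /(card_le_inj_on a)[s [sP sI]]; exists s => [x y|b]; last exact: sP.
exact: sI (mem_set I) (mem_set I).
Qed.

(** An injection of [kappa] into the union splits [kappa] into fewer than [kappa] classes, each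
    smaller than [kappa] and so bounded. The bounds have a common strict bound [b], yet [b] lies
    below the bound of its own class. *)
Lemma regular_bigcup J T (X : set J) (F : J -> set T) : X #< [set: kappa] ->
  (forall x, X x -> F x #< [set: kappa]) ->
  \bigcup_(x in X) F x #< [set: kappa].
Proof.
move=> X_lt F_lt; set U := \bigcup_(x in X) F x.
have [->|/set0P[u _]] := eqVneq U set0; first exact: finite_card_lt.
apply: card_ltNge => /(card_le_inj_on u)[f [fU fI]].
have /choice[c cP] k : exists x, X x /\ F x (f k).
  by have [x Xx Fx] := fU k I; exists x.
have /choice[a aP] x : exists a, X x -> forall k, c k = x -> (k < a)%O.
  have [Xx|nXx] := pselect (X x); last by have [o _] := regular_inhabited; exists o.
  have [|a aP] := @regular_bounded (c @^-1` [set x]); last by exists a => _ k; apply: aP.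
  apply: card_le_lt_trans (F_lt _ Xx); apply: (inj_on_card_le f).
    by move=> k <-; have [] := cP k.
  by move=> k l _ _; apply: fI; exact: mem_set I.
have aX_lt := card_le_lt_trans _ _ _ (card_image_le a X) X_lt.
have [b bP] := regular_bounded _ aX_lt.
have [Xcb _] := cP b.
have := aP _ Xcb b erefl; rewrite ltNge ltW //.
by apply: bP; exists (c b).
Qed.

(** * Closure properties of $P_\kappa(\lambda)$ *)

Context {lambda : Type}.
Implicit Types a b : Pkl kappa lambda.

Lemma elts_card_lt a : elts a #< [set: kappa].
Proof. by have [] : subsets_lt kappa [set: lambda] (sval a) := set_mem (valP a). Qed.

Lemma Pkl_ex (A : set lambda) : A #< [set: kappa] ->
  exists a : Pkl kappa lambda, elts a = A.
Proof.
move=> A_lt; have PA : A \in subsets_lt kappa [set: lambda] by apply: mem_set.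
by exists (exist _ A PA).
Qed.

Lemma Pkl_set0 : exists e : Pkl kappa lambda, elts e = set0.
Proof. by apply: Pkl_ex; exact: finite_card_lt. Qed.

Lemma Pkl_subset (A : set lambda) a : A `<=` elts a ->
  exists b : Pkl kappa lambda, elts b = A.
Proof.
move=> Aa; apply: Pkl_ex; apply: card_le_lt_trans (elts_card_lt a).
exact: subset_card_le.
Qed.

Lemma Pkl_setU (A : set lambda) a : A #< [set: kappa] ->
  exists b : Pkl kappa lambda, elts b = elts a `|` A.
Proof.
move=> A_lt; apply: Pkl_ex.
have -> : elts a `|` A = \bigcup_(i in [set: bool]) (if i then elts a else A).
  apply/seteqP; split=> [x [ax|Ax]|x [[] _]].
  - by exists true.
  - by exists false.
  - by left.
  - by right.
apply: regular_bigcup => [|[] _ //]; last exact: elts_card_lt.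
exact/finite_card_lt/finite_finset.
Qed.

Lemma Pkl_bigcup J (X : set J) (F : J -> Pkl kappa lambda) : X #< [set: kappa] ->
  exists b : Pkl kappa lambda, elts b = \bigcup_(x in X) elts (F x).
Proof.
by move=> X_lt; apply: Pkl_ex; apply: regular_bigcup => // x _; apply: elts_card_lt.
Qed.

(** * Disjoint cofinal families from traces on [kappa] *)

Context (iota : kappa -> lambda).
Hypothesis iota_inj : injective iota.

Lemma trace_bounded a : exists g, forall x, elts a (iota x) -> (x < g)%O.
Proof.
apply: (@regular_bounded (iota @^-1` elts a)).
apply: card_le_lt_trans (elts_card_lt a); apply: (inj_on_card_le iota) => // x y _ _.
exact: iota_inj.
Qed.

(* The trace of [b] on [kappa] is an initial segment minus one point [g]; a trace
   of this shape determines [g] and its length, and hence the label coded by the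
   length relative to [g]. *)
Lemma cofinal_disjoint_family : exists W : kappa -> set (Pkl kappa lambda),
  (forall x y b, W x b -> W y b -> x = y) /\
  forall x a, exists2 b, W x b & elts a `<=` elts b.
Proof.
have /choice[s sP] (g : kappa) : exists s : kappa -> kappa,
    injective s /\ forall x, (g < s x)%O.
  by have [s s_inj s_gt] := regular_tail_inj g; exists s.
have s_inj g : injective (s g) by have [] := sP g.
have s_gt g x : (g < s g x)%O by have [] := sP g.
pose tr g l : set kappa := [set z | (z < l)%O /\ z <> g].
(* If [g < g'], then [g] lies in the second trace but not in the first. *)
have tr_le g l g' l' : (g < l)%O -> (g' < l')%O -> tr g l = tr g' l' -> (g' <= g)%O.
  move=> gl gl' /seteqP[_ sub]; rewrite leNgt; apply/negP => gg'.
  have [|_ []//] := sub g; split; last by move=> E; rewrite E ltxx in gg'.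
  exact: lt_trans gl'.
(* The end of the shorter trace would lie in the longer one: it is above [g], hence not the omitted
   point. *)
have tr_inj g x y : tr g (s g x) = tr g (s g y) -> (s g y <= s g x)%O.
  move=> /seteqP[_ sub]; rewrite leNgt; apply/negP => lt.
  have [] := sub (s g x); last by rewrite ltxx.
  by split=> // E; have := s_gt g x; rewrite E ltxx.
exists (fun x => [set b | exists g, iota @^-1` elts b = tr g (s g x)]); split.
  move=> x y b [g Eg] [h Eh]; have E := etrans (esym Eg) Eh.
  have gh : g = h.
    apply: le_anti; rewrite (tr_le _ _ _ _ (s_gt g x) (s_gt h y) E).
    by rewrite (tr_le _ _ _ _ (s_gt h y) (s_gt g x) (esym E)).
  rewrite -gh in E; apply: (s_inj g); apply: le_anti.
  by rewrite (tr_inj _ _ _ E) (tr_inj _ _ _ (esym E)).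
move=> x a; have [g gP] := trace_bounded a.
(* The trace of [a] lies below [g], so it is absorbed by the trace that is added. *)
have [|b bE] := Pkl_setU (iota @` tr g (s g x)) a.
  apply: card_le_lt_trans (lt_segment_card (s g x)).
  apply: card_le_trans (card_image_le _ _) _; apply: subset_card_le => z [] //.
exists b; last by rewrite bE => z; left.
exists g; rewrite bE; apply/seteqP; split=> [z [/gP zg|[z' z'P /iota_inj <- //]]|z zP].
  split; first exact: lt_trans (s_gt g x).
  by move=> E; rewrite E ltxx in zg.
by right; exists z.
Qed.

(** * The two ideals and their completeness *)

Context (W : kappa -> set (Pkl kappa lambda)).
Hypothesis W_disjoint : forall x y b, W x b -> W y b -> x = y.
Hypothesis W_cofinal : forall x a, exists2 b, W x b & elts a `<=` elts b.

Lemma fibre_nonempty x : exists b, W x b.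
Proof. by have [e _] := Pkl_set0; have [b] := W_cofinal x e; exists b. Qed.

(* [p] is [False] for the ideal [H] and [True] for [K]; [l] matters only for [K]. *)
Definition basic_set (p : Prop) (l : kappa) (g : kappa -> Pkl kappa lambda) :
    set (Pkl kappa lambda) :=
  [set b | forall x, W x b -> (p /\ (x < l)%O) \/ ~ elts (g x) `<=` elts b].

(** Points outside all fibres lie in every basic set, so only the behaviour on the fibres counts. *)
Definition sum_ideal (p : Prop) : set (set (Pkl kappa lambda)) :=
  [set A | exists l g, A `<=` basic_set p l g].

Lemma basic_set_le p l l' g g' : (l <= l')%O ->
  (forall x, elts (g x) `<=` elts (g' x)) -> basic_set p l g `<=` basic_set p l' g'.
Proof.
move=> ll' gg' b bP x /bP[[pT xl]|ng]; [left|right].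
  by split=> //; apply: lt_le_trans ll'.
by apply: contra_not ng; apply: subset_trans.
Qed.

Lemma not_basic_set p l g : exists b, ~ basic_set p l g b.
Proof.
(* The exemption concerns indices strictly below [l], so the fibre at [l] itself is still
   constrained. *)
have [b Wb gb] := W_cofinal l (g l); exists b => /(_ l Wb)[[_]|//].
by rewrite ltxx.
Qed.

Lemma sum_ideal_sub p A B : sum_ideal p B -> A `<=` B -> sum_ideal p A.
Proof. by move=> [l [g Bg]] AB; exists l, g; apply: subset_trans Bg. Qed.

(** Fewer than [kappa] basic sets fit into one: the bounds have a common bound, and the functions
    are united pointwise. *)
Lemma sum_ideal_complete p (X : set (set (Pkl kappa lambda))) :
  X #< [set: kappa] -> X `<=` sum_ideal p -> sum_ideal p (\bigcup_(A in X) A).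
Proof.
move=> X_lt XH; have [o _] := regular_inhabited.
have [e _] := Pkl_set0.
have /choice[L LP] A : exists lg : kappa * (kappa -> Pkl kappa lambda),
    X A -> A `<=` basic_set p lg.1 lg.2.
  have [/XH[l [g Ag]]|nXA] := pselect (X A); last by exists (o, fun=> e).
  by exists (l, g).
have [|l lP] := regular_bounded ((fun A => (L A).1) @` X).
  exact: card_le_lt_trans (card_image_le _ _) X_lt.
have /choice[g gP] x := Pkl_bigcup _ X (fun A => (L A).2 x) X_lt.
exists l, g => b [A XA /(LP _ XA)]; apply: basic_set_le => [|x z Lz].
  by apply: ltW; apply: lP; exists A.
by rewrite gP; exists A.
Qed.

Lemma bounded_sum_ideal p : bounded_ideal kappa lambda `<=` sum_ideal p.
Proof.
have [o _] := regular_inhabited; move=> A [a /seteqP[Aa _]].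
by exists o, (fun=> a) => b Ab x _; right=> ab; apply: (Aa b).
Qed.

Lemma sum_ideal_is_Pkl_ideal p : is_Pkl_ideal (sum_ideal p).
Proof.
split; [split; last split|exact: sum_ideal_complete|exact: bounded_sum_ideal].
- have /choice[w wP] := fibre_nonempty.
  apply: contra_not regular_infinite; apply: card_le_finite.
  apply: (inj_on_card_le w) => // x y _ _ E; apply: (W_disjoint x y (w x)) => //.
  by rewrite E.
- move=> b; apply: bounded_sum_ideal; have [g gP] := trace_bounded b.
  (* As [g] bounds the trace of [b], the point [iota g] is not in [b]. *)
  have [a aE] : exists a : Pkl kappa lambda, elts a = [set iota g].
    by apply: Pkl_ex; exact/finite_card_lt/finite_set1.
  exists a; apply/seteqP; split=> [c [-> /=]|//]; rewrite aE => /(_ _ erefl)/gP.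
  by rewrite ltxx.
- by move=> A B HB AB; apply: sum_ideal_sub HB AB.
- by move=> X finX XH; apply: sum_ideal_complete => //; exact: finite_card_lt.
- by move=> [l [g gT]]; have [b] := not_basic_set p l g; apply; apply: gT.
Qed.

(** The witnesses of boundedness on the separate fibres are the values of a single function [g]. *)
Lemma sum_ideal_fibrewise p (A : set (Pkl kappa lambda)) :
  (forall x, bounded_ideal kappa lambda (A `&` W x)) -> sum_ideal p A.
Proof.
have [o _] := regular_inhabited; move=> /choice[g gP]; exists o, g => b Ab x Wb.
by right=> gb; have /seteqP[+ _] := gP x; apply; split; [split; [exact: Ab|exact: Wb]|].
Qed.

Lemma sum_ideal_fibre (p : Prop) x : p -> sum_ideal p (W x).
Proof.
move=> pT; have [l xl] := regular_succ x.
have [e _] := Pkl_set0.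
by exists l, (fun=> e) => b Wb y /W_disjoint/(_ Wb) ->; left.
Qed.

(** * Failure of the weak pi-point property, and the almost disjointness number *)

Lemma not_weak_pi_point : ~ weak_pi_point (sum_ideal True).
Proof.
have [[_ [_ _ _ nT]] _ _] := sum_ideal_is_Pkl_ideal True.
move=> /(_ W setT (fun x => sum_ideal_fibre True x I) nT)[B [nB _ BW]].
by apply: nB; exact: sum_ideal_fibrewise.
Qed.

Lemma positive_fibre x : positive (sum_ideal False) (W x).
Proof.
by move=> [l [g Wg]]; have [b Wb gb] := W_cofinal x (g x); have [[]|] := Wg b Wb x Wb.
Qed.

Lemma bounded_fibre x (A : set (Pkl kappa lambda)) :
  sum_ideal False (A `&` W x) -> bounded_ideal kappa lambda (A `&` W x).
Proof.
move=> [l [g Ag]]; exists (g x); apply/seteqP; split=> [b [AWb gb]|//].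
by have [[]|//] := Ag _ AWb x (snd AWb).
Qed.

Lemma fibres_mad : mad_families (sum_ideal False) (range W).
Proof.
have [_ _ bounded_sub] := sum_ideal_is_Pkl_ideal False.
split; first by move=> _ [x _ <-]; exact: positive_fibre.
split.
- apply: (inj_on_card_le W) => [x _|x y _ _ E]; first by exists x.
  by have [b Wb] := fibre_nonempty x; apply: (W_disjoint _ _ b Wb); rewrite -E.
- move=> _ _ [x _ <-] [y _ <-] WxWy.
  have [e _] := Pkl_set0; apply: bounded_sub; exists e.
  apply/seteqP; split=> [b [[Wx Wy] _]|//]; apply: WxWy.
  by rewrite (W_disjoint _ _ _ Wx Wy).
(* If no fibre met [C] in a positive set, [C] would be bounded on every fibre and so in the
   ideal. *)
- move=> C nC; apply: contrapT => CW; apply: nC; apply: sum_ideal_fibrewise => x.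
  apply: bounded_fibre; apply: contrapT => nCW; apply: CW.
  by exists (W x); [exists x|rewrite setIC].
Qed.

(** The lower bound is built into [mad_families]; the fibres give the upper bound and exclude the
    default value. *)
Lemma mad_number_kappa : [set: mad_number (sum_ideal False)] #= [set: kappa].
Proof.
rewrite /mad_number; case: pselect => [ne|[]]; last first.
  by exists (range W); exact: fibres_mad.
apply: card_eq_trans (card_setT _) _; apply/card_eqPle.
have [[_ [le _ _]] least] := least_cardP ne; split=> //.
exact: card_le_trans (least _ fibres_mad) (card_image_le _ _).
Qed.

(** * Cofinalities and dominating numbers *)

(* The code of [f] is the basic set of [f] and a bound of the trace of [f o] on
   [kappa]: no pair of a bound and a function is needed, hence no cardinal product. *)
Lemma dominating_cover p :
  exists code : (kappa -> Pkl kappa lambda) -> set (Pkl kappa lambda),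
  (forall f, sum_ideal p (code f)) /\
  forall A, sum_ideal p A -> exists g : kappa -> Pkl kappa lambda,
    forall x : set (kappa -> Pkl kappa lambda),
    (forall y, elts (g y) `<=` \bigcup_(f in x) elts (f y)) ->
    A `<=` \bigcup_(f in x) code f.
Proof.
have [o _] := regular_inhabited.
have /choice[l lP] (f : kappa -> Pkl kappa lambda) := trace_bounded (f o).
exists (fun f => basic_set p (l f) f); split=> [f|A [m [g Ag]]]; first by exists (l f), f.
(* The segment up to [m] is added to every value of [g], so that covering [h] at [o] yields, for
   each [z <= m], some [f] in [x] with [z < l f]. *)
have /choice[h hP] y : exists a : Pkl kappa lambda,
    elts a = elts (g y) `|` iota @` [set z | (z <= m)%O].
  apply: Pkl_setU; apply: card_le_lt_trans (lt_le_segment_card m).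
  exact: card_image_le.
exists h => x hx b /Ag bP.
have segP z : (z <= m)%O -> exists2 f, x f & (z < l f)%O.
  move=> zm; have [|f xf fz] := hx o (iota z); first by rewrite hP; right; exists z.
  by exists f => //; apply: lP.
(* A point in no fibre lies in every code; only the nonemptiness of [x] matters then. *)
have [[y Wy]|nW] := pselect (exists y, W y b); last first.
  have [f xf _] := segP m (le_refl _).
  by exists f => // y Wy; case: nW; exists y.
have [[pT ym]|ngb] := bP y Wy.
  have [f xf yf] := segP y (ltW ym).
  by exists f => // y' Wy'; left; rewrite (W_disjoint _ _ _ Wy' Wy).
(* A single element of [g y] missing from [b] suffices: some [f y] with [f] in [x] contains it. *)
have [z [gz nbz]] : exists z, elts (g y) z /\ ~ elts b z.
  apply: contrapT => nz; apply: ngb => z gz; apply: contrapT => nb.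
  by apply: nz; exists z.
have [|f xf fz] := hx y z; first by rewrite hP; left.
exists f => // y' Wy'; right; rewrite (W_disjoint _ _ _ Wy' Wy) => /(_ z fz).
exact: nbz.
Qed.

Lemma dom_numberP (g : kappa -> Pkl kappa lambda) :
  exists2 f, dom_number kappa lambda f & forall y, elts (g y) `<=` elts (f y).
Proof.
rewrite /dom_number; set P := (X in least_card X).
have [|dom _] := @least_cardP _ P; last exact: dom.
by exists setT => h; exists h => // alpha z.
Qed.

Lemma dombar_numberP (g : kappa -> Pkl kappa lambda) :
  exists2 x, subsets_lt kappa (dombar_number kappa lambda) x &
    forall y, elts (g y) `<=` \bigcup_(f in x) elts (f y).
Proof.
rewrite /dombar_number; set P := (X in least_card X).
have [|dom _] := @least_cardP _ P; last exact: dom.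
exists setT => h; exists [set h]; last by move=> y z hz; exists h.
by split=> //; apply: finite_card_lt; exact: finite_set1.
Qed.

Definition generates p (X : set (set (Pkl kappa lambda))) :=
  X `<=` sum_ideal p /\ sum_ideal p = \bigcup_(A in X) [set B | B `<=` A].

Lemma generates_self p : generates p (sum_ideal p).
Proof.
split=> //; apply/seteqP; split=> [A HA|A [B HB]]; first by exists A.
exact: sum_ideal_sub.
Qed.

(** The codes of a dominating family generate the ideal, by [dominating_cover] with [x] a
    singleton. *)
Lemma cof_le_dom_number p : cof (sum_ideal p) #<= dom_number kappa lambda.
Proof.
have [code [codeH codeP]] := dominating_cover p.
have [_ least] := least_cardP (ex_intro _ _ (generates_self p)).
apply: card_le_trans (card_image_le code _); apply: least; split=> [_ [f _ <-] //|].
apply/seteqP; split=> [A /codeP[g gP]|A [_ [f _ <-]]]; last exact: sum_ideal_sub.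
have [f df gf] := dom_numberP g; exists (code f); first by exists f.
have := gP [set f]; rewrite bigcup_set1; apply=> y.
by rewrite bigcup_set1.
Qed.

(** Here [dominating_cover] is used with [x] of size less than [kappa]; completeness keeps the
    unions of codes in the ideal. *)
Lemma cofbar_le_dombar_number p :
  cofbar kappa (sum_ideal p) #<= dombar_number kappa lambda.
Proof.
have [code [codeH codeP]] := dominating_cover p.
suff gen : code @` dombar_number kappa lambda `<=` sum_ideal p /\ sum_ideal p =
    \bigcup_(x in subsets_lt kappa (code @` dombar_number kappa lambda))
      [set B | B `<=` \bigcup_(A in x) A].
  rewrite /cofbar; set P := (X in least_card X).
  have [_ least] := @least_cardP _ P (ex_intro _ _ gen).
  by apply: card_le_trans (card_image_le code _); apply: least.
split=> [_ [f _ <-] //|]; apply/seteqP; split=> [A /codeP[g gP]|A [x [xX x_lt] Ax]].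
  have [x [xD x_lt] /gP Ax] := dombar_numberP g.
  exists (code @` x); last by rewrite /= bigcup_image.
  split=> [_ [f xf <-]|]; first by exists f => //; apply: xD.
  exact: card_le_lt_trans (card_image_le _ _) x_lt.
apply: sum_ideal_sub Ax; apply: sum_ideal_complete => // B /xX[f _ <-] //.
Qed.

(* If [A] is inside the basic set of [m] and [f], then for [x >= m] every member
   of [W x] containing [f x] must contain [g x]; as [g] is increasing, bounding it
   at the indices above [m] is enough. *)
Lemma dominated_by_ideal p A : sum_ideal p A -> exists h : kappa -> Pkl kappa lambda,
  forall (l : kappa) (g : kappa -> Pkl kappa lambda),
    (forall x y, (x <= y)%O -> elts (g x) `<=` elts (g y)) ->
    basic_set p l g `<=` A -> forall y, elts (g y) `<=` elts (h y).
Proof.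
move=> [m [f Af]].
(* Cofinality of [W x] gives a member containing [f x]; the intersection lies inside it and is thus
   small. *)
have /choice[h hP] x : exists h : Pkl kappa lambda,
    elts h = \bigcap_(b in [set b | W x b /\ elts (f x) `<=` elts b]) elts b.
  have [b Wb fb] := W_cofinal x (f x); apply: (Pkl_subset _ b) => z; apply; split=> //.
(* An index of at least [m] rules out the exemption [x < m]. *)
exists (fun y => h (Order.max y m)) => l g g_le gA y.
set x := Order.max y m; apply: subset_trans (g_le y x _) _.
  by rewrite /x le_max le_refl.
(* If [b] missed [z], it would be in the basic set of [g], hence in [A], hence in that of [f],
   although it contains [f x]. *)
rewrite hP => z gz b [Wb fb]; apply: contrapT => nbz.
have [||]// := Af b (gA b _) x Wb.
  move=> x' Wb'; right; rewrite (W_disjoint _ _ _ Wb' Wb) => /(_ z gz); exact: nbz.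
case=> _; rewrite ltNge /x le_max.
by rewrite le_refl orbT.
Qed.

(** Applying [dominated_by_ideal] to each member of a least generating family gives a dominating
    family that is no larger. *)
Lemma dom_number_le_cof p : dom_number kappa lambda #<= cof (sum_ideal p).
Proof.
have [o _] := regular_inhabited; have [e _] := Pkl_set0.
have [[cofH cofE] _] := least_cardP (ex_intro _ _ (generates_self p)).
rewrite -/(cof _) in cofH cofE.
have /choice[h hP] A : exists h : kappa -> Pkl kappa lambda, sum_ideal p A ->
    forall (l : kappa) (g : kappa -> Pkl kappa lambda),
    (forall x y, (x <= y)%O -> elts (g x) `<=` elts (g y)) ->
    basic_set p l g `<=` A -> forall y, elts (g y) `<=` elts (h y).
  have [/dominated_by_ideal[h]|nA] := pselect (sum_ideal p A); first by exists h.
  by exists (fun=> e).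
suff dom : forall g : kappa -> Pkl kappa lambda, exists2 f, (h @` cof (sum_ideal p)) f &
    forall y, elts (g y) `<=` elts (f y).
  rewrite /dom_number; set P := (X in least_card X).
  have [_ least] := @least_cardP _ P (ex_intro _ _ dom).
  by apply: card_le_trans (card_image_le h _); apply: least.
move=> g.
(* An increasing majorant of [g], as [dominated_by_ideal] requires; regularity keeps its values in
   $P_\kappa(\lambda)$. *)
have /choice[g' gP] x := Pkl_bigcup _ [set y | (y <= x)%O] g (lt_le_segment_card x).
have [A cA g'A] : exists2 A, cof (sum_ideal p) A & basic_set p o g' `<=` A.
  have : sum_ideal p (basic_set p o g') by exists o, g'.
  by rewrite [in X in X -> _]cofE.
exists (h A); first by exists A.
move=> y; apply: subset_trans (hP A (cofH _ cA) o g' _ g'A y).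
  by move=> z gz; rewrite gP; exists y => //=.
move=> x x' xx' z; rewrite !gP => -[y' /= y'x gz]; exists y' => //=.
exact: le_trans xx'.
Qed.

End RegularCardinal.

Theorem theorem8p6 (d d' : Order.disp_t)
    (kappa : orderType d) (lambda : orderType d')
    (regular_kappa : regular_uncountable kappa)
    (cardinal_lambda : is_cardinal lambda)
    (kappa_lt_lambda : [set: kappa] #< [set: lambda]) :
  (exists H : set (set (Pkl kappa lambda)),
    is_Pkl_ideal H /\
    [/\ [set: mad_number H] #= [set: kappa],
        cof H #= dom_number kappa lambda &
        cofbar kappa H #<= dombar_number kappa lambda]) /\
  (exists K : set (set (Pkl kappa lambda)),
    is_Pkl_ideal K /\
    [/\ ~ weak_pi_point K,
        cof K #= dom_number kappa lambda &
        cofbar kappa K #<= dombar_number kappa lambda]).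
Proof.
have [o _] := regular_inhabited kappa regular_kappa.
have [kl _] := kappa_lt_lambda.
have [u _] : exists u : lambda, True.
  by have /card_leP[f] := kl; exists (sval (f (SigSub (mem_set (I : [set: kappa] o))))).
have [iota [_ iota_in]] := card_le_inj_on u kl.
have iota_inj : injective iota by move=> x y; apply: iota_in; exact: mem_set.
have [W [W_disjoint W_cofinal]] :=
  cofinal_disjoint_family kappa regular_kappa iota iota_inj.
have cofE p : cof (sum_ideal kappa W p) #= dom_number kappa lambda.
  apply/card_eqPle; split; last exact: dom_number_le_cof.
  exact: (cof_le_dom_number _ regular_kappa iota).
have cofbarE p : cofbar kappa (sum_ideal kappa W p) #<= dombar_number kappa lambda.
  exact: (cofbar_le_dombar_number _ regular_kappa iota).
split; [exists (sum_ideal kappa W False)|exists (sum_ideal kappa W True)].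
  split; first exact: (sum_ideal_is_Pkl_ideal _ regular_kappa iota).
  split; [exact: (mad_number_kappa _ regular_kappa iota)|exact: cofE|exact: cofbarE].
split; first exact: (sum_ideal_is_Pkl_ideal _ regular_kappa iota).
split; [exact: (not_weak_pi_point _ regular_kappa iota)|exact: cofE|exact: cofbarE].
Qed.
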